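(* Let $V$ be an infinite-dimensional complex inner product space with full antidual $V'$. For $\xi, \eta \in V'$ put $$[\xi | \eta] := \lim_{M \uparrow \mathcal{F}(V)} \langle \xi_M | \eta_M \rangle$$ whenever this limit exists. If $x, y \in V$ and $\xi, \eta \in V'$, then $[x' | \eta]$ and $[\xi | y']$ are defined (the limits exist) and $$[x' | \eta] = \eta(x), \qquad [\xi | y'] = \overline{\xi(y)}.$$
   Context: The inner product $\langle \bullet | \bullet \rangle$ on $V$ is antilinear in the first slot and linear in the second; no completeness of $V$ is assumed. The full antidual $V'$ is the complex vector space of all antilinear maps $V \to \mathbb{C}$, bounded or not. For $v \in V$, $v' \in V'$ is defined by $v'(z) = \langle z | v \rangle$ for all $z \in V$. $\mathcal{F}(V)$ is the set of all finite-dimensional complex subspaces of $V$, directed by inclusion. For $\zeta \in V'$ and $M \in \mathcal{F}(V)$, $\zeta_M \in M$ is the unique vector such that $\zeta(z) = \langle z | \zeta_M \rangle$ for all $z \in M$. *)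

(* Defs.v *)
From HB Require Import structures.
From mathcomp Require Import all_boot all_order all_algebra.
From mathcomp Require Import complex.
From mathcomp Require Import all_classical all_reals all_analysis.

Set Implicit Arguments.
Unset Strict Implicit.
Unset Printing Implicit Defensive.

Import Order.TTheory GRing.Theory Num.Theory.
Import numFieldNormedType.Exports.

Local Open Scope complex_scope.
Local Open Scope classical_set_scope.
Local Open Scope ring_scope.

(* Complex inner products; [dot] is linear in its first argument and
   antilinear in its second one, see [braket] below. *)
Notation innerProduct V := {dot V for (@Num.conj _)}.

(* All antilinear maps V -> C, without any continuity requirement: additive
   maps f such that f (a *: v) = a^* * f v. *)
Notation antidual R V :=
  {linear V%type -> R[i] | (@Num.conj R[i] : R[i] -> R[i]) \; *%R}.

Section FiniteDimensional.
Variables (R : realType) (V : lmodType R[i]).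

Definition lin_span (s : seq V) : set V :=
  [set v | exists c : 'I_(size s) -> R[i], v = \sum_(i < size s) c i *: s`_i].

Definition finite_dimensional (M : set V) : Prop :=
  exists s : seq V, M = lin_span s.

Record finSubspace := FinSubspace {
  finSubspace_set :> set V;
  finSubspace_submod : submod_closed (mem finSubspace_set);
  finSubspace_findim : finite_dimensional finSubspace_set
}.

(* The filter of tails of the set of finite-dimensional subspaces, directed by
   inclusion: a limit along it is the limit of the corresponding net. *)
Definition finSubspace_up : set_system finSubspace :=
  filter_from [set: finSubspace] (fun M => [set N : finSubspace | M `<=` N]).

End FiniteDimensional.
Arguments finSubspace_up {R} V _.

Section Antidual.
Variables (R : realType) (V : lmodType R[i]) (dot : innerProduct V).

(* <x | y>, antilinear in x and linear in y: the arguments of [dot] are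
   swapped. *)
Definition braket (x y : V) : R[i] := dot y x.

(* The antilinear form v' = <_ | v>. *)
Definition vprime (v : V) : V -> R[i] := fun z => braket z v.

Fact vprime_antilinear v :
  GRing.linear_for ((@Num.conj R[i] : R[i] -> R[i]) \; *%R) (vprime v).
Proof. exact: linearPr. Qed.

HB.instance Definition _ v :=
  GRing.isLinear.Build R[i] V R[i] _ (vprime v) (vprime_antilinear v).

(* zeta_M, the unique vector of M representing the restriction of zeta to M.
   It always exists as M has finite dimension, so that the default value 0 is
   irrelevant. *)
Definition riesz (zeta : antidual R V) (M : finSubspace V) : V :=
  xget 0 [set m | (M : set V) m /\ forall z, (M : set V) z -> zeta z = braket z m].

(* The regular module R[i]^o carries the usual topology of C. *)
Definition bracket_net (xi eta : antidual R V) (M : finSubspace V) : R[i]^o :=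
  braket (riesz xi M) (riesz eta M).

Definition bracket_defined (xi eta : antidual R V) : Prop :=
  cvg (bracket_net xi eta M @[M --> finSubspace_up V]).

(* [xi | eta]; meaningful only if [bracket_defined xi eta]. *)
Definition bracket (xi eta : antidual R V) : R[i] :=
  lim (bracket_net xi eta M @[M --> finSubspace_up V]).

End Antidual.

(* Main.v *)
Require Import Defs.
From HB Require Import structures.
From mathcomp Require Import all_boot all_order all_algebra.
From mathcomp Require Import complex.
From mathcomp Require Import all_classical all_reals all_analysis.

Set Implicit Arguments.
Unset Strict Implicit.
Unset Printing Implicit Defensive.

Import Order.TTheory GRing.Theory Num.Theory.
Import numFieldNormedType.Exports.

Local Open Scope complex_scope.
Local Open Scope classical_set_scope.
Local Open Scope ring_scope.

(** Both nets are eventually constant.  A finite-dimensional subspace M that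
    contains x represents x' by x itself ([riesz_vprime]), because a
    representing vector is unique in M by definiteness of the inner product.
    Hence the net of [x' | eta] takes at every such M the value
    <x | eta_M> = eta x, by the defining property of eta_M and x \in M; by
    conjugate symmetry the net of [xi | y'] takes the value
    <xi_M | y> = (xi y)^* at every M that contains y.

    Three facts make this rigorous.  The vector zeta_M exists ([rieszP]): it is
    built by induction on a spanning family, as in Gram-Schmidt
    ([lin_span_riesz]).  The subspaces containing a given vector form a tail of
    the directed set ([near_mem_finSubspace]).  The tails form a proper filter
    ([finSubspace_up_proper]) because the span of a concatenation contains both
    spans; limits along it in the Hausdorff plane are therefore unique, and the
    limit of an eventually constant net is that constant
    ([bracket_near_cst]). *)

Lemma lin_span_nil (R : realType) (V : lmodType R[i]) (v : V) :
  lin_span [::] v <-> v = 0.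
Proof.
split=> [[c ->]|->]; first by rewrite big_ord0.
by exists (fun=> 0); rewrite big_ord0.
Qed.

(** The recursive description of spans, by which later facts are proved by
    induction on the spanning family instead of manipulating coefficients. *)
Lemma lin_span_cons (R : realType) (V : lmodType R[i]) (a : V) (s : seq V)
    (v : V) :
  lin_span (a :: s) v <-> exists k w, lin_span s w /\ v = k *: a + w.
Proof.
split=> [[c ->]|[k [w [[c ->] ->]]]].
  rewrite big_ord_recl /=.
  exists (c ord0), (\sum_(i < size s) c (lift ord0 i) *: s`_i).
  by split=> //; exists (fun i => c (lift ord0 i)).
exists (fun i => if unlift ord0 i is Some j then c j else k).
rewrite big_ord_recl /= unlift_none; congr (_ + _).
by apply: eq_bigr => i _; rewrite liftK.
Qed.

Lemma lin_span0 (R : realType) (V : lmodType R[i]) (s : seq V) :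
  lin_span s (0 : V).
Proof.
by exists (fun=> 0); rewrite big1 // => i _; rewrite scale0r.
Qed.

Lemma lin_spanP (R : realType) (V : lmodType R[i]) (s : seq V) (k : R[i])
    (u v : V) :
  lin_span s u -> lin_span s v -> lin_span s (k *: u + v).
Proof.
move=> [c ->] [d ->]; exists (fun i => k * c i + d i).
rewrite scaler_sumr -big_split; apply: eq_bigr => i _ /=.
by rewrite scalerA -scalerDl.
Qed.

Lemma lin_spanB (R : realType) (V : lmodType R[i]) (s : seq V) (u v : V) :
  lin_span s u -> lin_span s v -> lin_span s (u - v).
Proof.
by move=> su sv; rewrite addrC -scaleN1r; exact: lin_spanP.
Qed.

Lemma lin_span_catl (R : realType) (V : lmodType R[i]) (s t : seq V) :
  lin_span s `<=` lin_span (s ++ t).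
Proof.
elim: s => [|a s IHs] v; first by move/lin_span_nil->; exact: lin_span0.
move=> /lin_span_cons[k [w [sw ->]]]; apply/lin_span_cons.
by exists k, w; split=> //; exact: IHs.
Qed.

Lemma lin_span_catr (R : realType) (V : lmodType R[i]) (s t : seq V) :
  lin_span t `<=` lin_span (s ++ t).
Proof.
elim: s => [//|a s IHs] v tv; apply/lin_span_cons.
by exists 0, v; split; [exact: IHs|rewrite scale0r add0r].
Qed.

Lemma lin_span_submod (R : realType) (V : lmodType R[i]) (s : seq V) :
  submod_closed (mem (lin_span s)).
Proof.
split=> [|k u v]; first by rewrite inE; exact: lin_span0.
by rewrite !inE; exact: lin_spanP.
Qed.

Definition span_subspace (R : realType) (V : lmodType R[i]) (s : seq V) :
    finSubspace V :=
  FinSubspace (lin_span_submod s) (ex_intro _ s erefl).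

Lemma mem_span_subspace1 (R : realType) (V : lmodType R[i]) (x : V) :
  (span_subspace [:: x] : set V) x.
Proof.
apply/lin_span_cons; exists 1, 0.
by split; [exact: lin_span0|rewrite scale1r addr0].
Qed.

(** Directedness of the finite-dimensional subspaces: if s spans M and t spans
    N, then s ++ t spans an upper bound of M and N. *)
Lemma finSubspace_up_proper (R : realType) (V : lmodType R[i]) :
  ProperFilter (finSubspace_up V).
Proof.
apply: filter_from_proper; last by move=> M _; exists M => v.
apply: filter_from_filter; first by exists (span_subspace [::]).
move=> M N _ _.
have [s Ms] := finSubspace_findim M; have [t Nt] := finSubspace_findim N.
exists (span_subspace (s ++ t)) => // P stP; split=> v.
  by rewrite Ms => sv; apply: stP; exact: lin_span_catl.
by rewrite Nt => tv; apply: stP; exact: lin_span_catr.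
Qed.

Lemma near_mem_finSubspace (R : realType) (V : lmodType R[i]) (x : V) :
  finSubspace_up V [set M : finSubspace V | (M : set V) x].
Proof.
by exists (span_subspace [:: x]) => // M; apply; exact: mem_span_subspace1.
Qed.

Section Riesz.
Variables (R : realType) (V : lmodType R[i]) (dot : innerProduct V).
Implicit Types (zeta : antidual R V) (M : finSubspace V).

Lemma braketC u v : braket dot u v = Num.conj (braket dot v u).
Proof. by rewrite /braket hermC expr0 mul1r. Qed.

Lemma braketPr u k v w :
  braket dot u (k *: v + w) = k * braket dot u v + braket dot u w.
Proof. by rewrite /braket linearPl. Qed.

Lemma braketPl k u v w :
  braket dot (k *: u + v) w = Num.conj k * braket dot u w + braket dot v w.
Proof. by rewrite /braket linearPr. Qed.

Lemma braketBr u v w :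
  braket dot u (v - w) = braket dot u v - braket dot u w.
Proof. by rewrite /braket linearBl. Qed.

Lemma braket_eq0 u : braket dot u u = 0 -> u = 0.
Proof. by move=> /eqP; rewrite /braket dnorm_eq0 => /eqP. Qed.

Lemma antidualP zeta k u v :
  zeta (k *: u + v) = Num.conj k * zeta u + zeta v.
Proof. by rewrite linearP. Qed.

(** Adjoining a to the family s, the induction hypothesis is used twice: for
    zeta, giving m, and for a', giving the orthogonal projection p of a on the
    span of s.  Then b := a - p is orthogonal to that span and spans with it
    the new subspace, so that adding to m a multiple of b corrects the value
    at b without changing the values on the span of s. *)
Lemma lin_span_riesz zeta s :
  exists2 m, lin_span s m & forall z, lin_span s z -> zeta z = braket dot z m.
Proof.
elim: s zeta => [|a s IHs] zeta.
  exists 0 => [|z /lin_span_nil->]; first exact: lin_span0.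
  by rewrite linear0 /braket linear0r.
have [m sm mP] := IHs zeta; have [p sp pP] := IHs (vprime dot a).
pose b := a - p.
have ortho z : lin_span s z -> braket dot z b = 0.
  by move=> sz; rewrite braketBr -pP// subrr.
pose c := zeta b / braket dot b b.
have zetab : zeta b = c * braket dot b b.
  (* If <b | b> = 0 then b = 0, i.e. a was already in the span of s, and both
     sides vanish. *)
  have [b0|b0] := eqVneq (braket dot b b) 0; last by rewrite divfK.
  by rewrite b0 mulr0 (braket_eq0 b0) linear0.
have split_span z : lin_span (a :: s) z ->
    exists k w, lin_span s w /\ z = k *: b + w.
  move=> /lin_span_cons[k [w [sw ->]]]; exists k, (k *: p + w).
  by split; [exact: lin_spanP|rewrite scalerBr addrA subrK].
exists (c *: b + m).
  apply/lin_span_cons; exists c, (m - c *: p); split; last first.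
    by rewrite scalerBr -addrA [- _ + m]addrC.
  by rewrite addrC -scaleNr; exact: lin_spanP.
move=> z /split_span[k [w [sw ->]]].
have bm0 : braket dot b m = 0 by rewrite braketC ortho// conjC0.
by rewrite antidualP zetab (mP w sw) braketPl !braketPr bm0 (ortho _ sw) mulr0
  addr0 add0r.
Qed.

Lemma rieszP zeta M : (M : set V) (riesz dot zeta M) /\
  forall z, (M : set V) z -> zeta z = braket dot z (riesz dot zeta M).
Proof.
have [s Ms] := finSubspace_findim M; have [m sm mP] := lin_span_riesz zeta s.
have ex_m : exists m, (M : set V) m /\
    forall z, (M : set V) z -> zeta z = braket dot z m.
  by exists m; rewrite Ms.
by have := xgetPex 0 ex_m.
Qed.

(** If m represents x' on M, then m - x lies in M and is orthogonal to M, hence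
    to itself. *)
Lemma riesz_vprime x M : (M : set V) x -> riesz dot (vprime dot x) M = x.
Proof.
move=> Mx; have [Mm mP] := rieszP (vprime dot x) M.
move: (riesz dot _ M) Mm mP => m Mm mP; apply/eqP; rewrite -subr_eq0.
apply/eqP/braket_eq0.
have [s Ms] := finSubspace_findim M.
have Mmx : (M : set V) (m - x) by move: Mm Mx; rewrite Ms; exact: lin_spanB.
by rewrite braketBr -(mP _ Mmx) subrr.
Qed.

Lemma bracket_near_cst xi eta l :
    finSubspace_up V [set M | bracket_net dot xi eta M = l] ->
  bracket_defined dot xi eta /\ bracket dot xi eta = l.
Proof.
have FF := @finSubspace_up_proper R V => net_l; split.
  by apply/cvg_ex; exists l; exact: cvg_near_cst net_l.
exact: (lim_near_cst (@norm_hausdorff _ _) net_l).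
Qed.

End Riesz.

Theorem mainTheorem3 (R : realType) (V : lmodType R[i]) (dot : innerProduct V)
    (infinite_dim : ~ finite_dimensional [set: V])
    (x y : V) (xi eta : antidual R V) :
  (bracket_defined dot (vprime dot x) eta /\
   bracket dot (vprime dot x) eta = eta x) /\
  (bracket_defined dot xi (vprime dot y) /\
   bracket dot xi (vprime dot y) = Num.conj (xi y)).
Proof.
have FF := @finSubspace_up_proper R V.
split; apply: bracket_near_cst.
  apply: filterS (near_mem_finSubspace x) => M /= Mx.
  by rewrite /bracket_net riesz_vprime// -(rieszP dot eta M).2.
apply: filterS (near_mem_finSubspace y) => M /= My.
by rewrite /bracket_net riesz_vprime// braketC -(rieszP dot xi M).2.
Qed.
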